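(* Let a sender $s$ transmit a packet with power $P_{Ts}>0$ to its candidate forwarding set, which consists of $n_{rel}\ge 1$ nodes $r_1,\dots,r_{n_{rel}}$, in the interference and Rayleigh fading model described in the context. For each $j$, let $d_{r_js}>0$ be the distance from $s$ to $r_j$, let $r_j$ have $m_j\ge 0$ interference nodes (other than $s$), with transmission powers $P_{T1}^{(j)},\dots,P_{Tm_j}^{(j)}>0$ and distances $d_{r_j1},\dots,d_{r_jm_j}>0$ to $r_j$. Then the probability $P_{sc}(P_{Ts},n_{rel})$ that the packet is received successfully by the candidate forwarding set (i.e. by at least one of $r_1,\dots,r_{n_{rel}}$) is $$P_{sc}(P_{Ts},n_{rel})=1-\prod_{j=1}^{n_{rel}}\left(1-\exp\left[-\frac{\beta P_n d_{r_js}^{\eta}}{P_{Ts}K}\right]\prod_{i=1}^{m_j}\frac{1}{1+\dfrac{\beta P_{Ti}^{(j)}}{G\,P_{Ts}\,(d_{r_ji}/d_{r_js})^{\eta}}}\right).$$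
   Context: Positive constants: $\eta$ (propagation loss coefficient, $2\le\eta\le5$), $K$ (overall antenna gain), $G$ (processing gain), $P_n$ (noise power at a receiver), $\beta$ (SINR decoding threshold). Fading model: at a receiver $r$ at distance $d_{rs}$ from $s$, the power received from $s$ is $\frac{K\alpha_{rs}^2}{d_{rs}^{\eta}}P_{Ts}$. If $r$ has $m$ interference nodes with powers $P_{T1},\dots,P_{Tm}$ at distances $d_{r1},\dots,d_{rm}$ from $r$, the interference plus noise at $r$ is $\frac1G\sum_{i=1}^m\frac{K\alpha_{ri}^2}{d_{ri}^{\eta}}P_{Ti}+P_n$. Here $\alpha_{rs}^2,\alpha_{r1}^2,\dots,\alpha_{rm}^2$ are independent exponential random variables with mean $1$ (Rayleigh fading). The SINR at $r$ is the ratio of the power received from $s$ to the interference plus noise, and $r$ receives the packet successfully if and only if its SINR is at least $\beta$. The reception events at distinct nodes of the candidate forwarding set are independent, so that if $P_{sj}$ is the probability that $r_j$ receives the packet successfully, then $P_{sc}=1-\prod_{j=1}^{n_{rel}}(1-P_{sj})$. *)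

(* Defs.v *)
From HB Require Import structures.
From mathcomp Require Import all_boot all_order all_algebra.
From mathcomp Require Import all_classical all_reals all_analysis.

Set Implicit Arguments.
Unset Strict Implicit.
Unset Printing Implicit Defensive.

Import Order.TTheory GRing.Theory Num.Theory.
Import numFieldNormedType.Exports.

Local Open Scope classical_set_scope.
Local Open Scope ring_scope.

Section Probability.
Context {disp : measure_display} {T : measurableType disp} {R : realType}.
Variable P : probability T R.

Definition independent_events (I : finType) (E : I -> set T) : Prop :=
  forall J : {set I},
    P (\bigcap_(i in [set` J]) E i) = (\prod_(i in J) P (E i))%E.

Definition independent_RVs (I : finType) (X : I -> {RV P >-> R}) : Prop :=
  forall B : I -> set R, (forall i, measurable (B i)) ->
    independent_events (fun i => X i @^-1` B i).

(* [exponential_prob] is parameterized by the rate, the inverse of the mean. *)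
Definition exponential_RV (mean : R) (X : {RV P >-> R}) : Prop :=
  forall A : set R, measurable A ->
    distribution P X A = exponential_prob mean^-1 A.

End Probability.

Section Fading.
Context {R : realType}.

(* Power received over distance [dist] from a node transmitting with power
   [pow]; [gain] is the squared fading coefficient alpha^2. *)
Definition received_power (K eta dist pow gain : R) : R :=
  K * gain / dist `^ eta * pow.

Definition interference_plus_noise (K eta G Pn : R) (m : nat)
    (dist pow gain : 'I_m -> R) : R :=
  G^-1 * (\sum_(i < m) received_power K eta (dist i) (pow i) (gain i)) + Pn.

(* Links into a receiver with [m] interferers are indexed by [option 'I_m]:
   [None] is the link from the sender, [Some i] the one from interferer [i]. *)
Definition SINR (K eta G Pn : R) (m : nat) (dist_s pow_s : R)
    (dist pow : 'I_m -> R) (gain : option 'I_m -> R) : R :=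
  received_power K eta dist_s pow_s (gain None) /
  interference_plus_noise K eta G Pn dist pow (fun i => gain (Some i)).

Definition reception {T : Type} (K eta G Pn beta : R) (m : nat)
    (dist_s pow_s : R) (dist pow : 'I_m -> R)
    (gain : option 'I_m -> T -> R) : set T :=
  [set t | beta <= SINR K eta G Pn dist_s pow_s dist pow (fun l => gain l t)].

End Fading.

(* Main.v *)
(* Outside a null set all gains are nonnegative, so reception means
   [c <= X0 - \sum_i a_i X_i] with X0 the gain of the sender. The interferers are
   removed one at a time: X_i is independent of W = X0 - \sum_(k < i) a_k X_k,
   whose tail is C e^-c for c >= 0 (memorylessness), so by Fubini
   P(c <= W - a_i X_i) = E[C e^-(c + a_i X_i)] = C e^-c / (1 + a_i).
   The events of no reception are independent as well, which gives the union. *)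
Require Import Defs.
From HB Require Import structures.
From mathcomp Require Import all_boot all_order all_algebra.
From mathcomp Require Import all_classical all_reals all_analysis.
From mathcomp Require Import measurable_realfun ring.

Set Implicit Arguments.
Unset Strict Implicit.
Unset Printing Implicit Defensive.

Import Order.TTheory GRing.Theory Num.Theory.
Import numFieldNormedType.Exports.

Local Open Scope classical_set_scope.
Local Open Scope ring_scope.

(** * Tail and Laplace transform of an exponential law on the line *)

Section ExponentialLaw.
Context {R : realType}.
Variables (nu : probability (measurableTypeR R) R) (rate : R).
Hypothesis rate_gt0 : 0 < rate.
Hypothesis nuE : forall A, measurable A -> nu A = exponential_prob rate A.
Local Notation mu := (@lebesgue_measure R).

Lemma exponential_law_dom : nu `<< mu.
Proof.
apply/null_content_dominatesP => A mA muA0; rewrite nuE//.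
apply: null_set_integral => //=.
apply/measurable_EFinP/measurable_funTS.
exact: measurable_exponential_pdf.
Qed.

(** The Radon-Nikodym derivative of [nu] and the exponential density have the same integral over
    every measurable subset of [U], so they agree almost everywhere on [U]. *)
Lemma integral_exponential_law (f : R -> \bar R) (U : set R) :
    measurable U -> nu.-integrable U f ->
  (\int[nu]_(x in U) f x =
   \int[mu]_(x in U) (f x * (exponential_pdf rate x)%:E))%E.
Proof.
move=> mU fint; have mf := measurable_int _ fint.
have mpdf : measurable_fun U (EFin \o exponential_pdf rate).
  by apply/measurable_EFinP/measurable_funTS; exact: measurable_exponential_pdf.
rewrite -(Radon_Nikodym_change_of_variables exponential_law_dom)//=.
have mRN : mu.-integrable [set: R] (Radon_Nikodym (charge_of_finite_measure nu) mu).
  by apply: Radon_Nikodym_integrable; exact: exponential_law_dom.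
apply: ae_eq_integral => //.
- apply: emeasurable_funM => //; apply: (measurable_int mu).
  exact: (integrableS _ _ (@subsetT _ _) mRN).
- exact: emeasurable_funM.
- apply: ae_eqe_mul2l => /=.
  apply: integral_ae_eq => //=.
  + exact: (integrableS _ _ (@subsetT _ _) mRN).
  + move=> E EU mE.
    rewrite -Radon_Nikodym_integral//; last exact: exponential_law_dom.
    exact: nuE.
Qed.

(** The density has antiderivative [- expR (- rate * x)], which tends to 0 at infinity. *)
Lemma exponential_law_itvcy (x : R) : 0 <= x ->
  nu `[x, +oo[%classic = (expR (- rate * x))%:E.
Proof.
move=> x0; rewrite nuE// /exponential_prob.
have cexp : continuous (fun z : R^o => expR (- rate * z)).
  move=> z; apply: continuous_comp; last exact: continuous_expR.
  by apply: continuousM => //; apply: (@continuousN _ R^o); exact: cst_continuous.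
rewrite (@ge0_continuous_FTC2y _ _ (fun x => - (expR (- rate * x))) _ 0)//.
- by rewrite EFinN oppeK add0e.
- by move=> z _; apply: exponential_pdf_ge0; exact: ltW.
- apply: (@continuous_subspaceW R^o _ _ [set` `[0, +oo[%R]).
  + by move=> z /=; rewrite !in_itv/= !andbT; exact: le_trans.
  + exact: within_continuous_exponential_pdf.
- rewrite -oppr0; apply: cvgN.
  rewrite (_ : (fun x => expR (- rate * x)) =
               (fun z => expR (- z)) \o (fun z => rate * z)); last first.
    by apply: eq_fun => z; rewrite mulNr.
  apply: (@cvg_comp _ _ _ _ _ _ (pinfty_nbhs R)); last exact: cvgr_expR.
  exact: gt0_cvgMry.
- by apply: cvgN; apply/cvg_at_right_filter; exact: cexp.
- move=> z; rewrite in_itv/= andbT => xz; apply: derive1_exponential_pdf.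
  by rewrite in_itv/= andbT (le_lt_trans x0).
Qed.

Lemma exponential_law_lt0 : nu `]-oo, 0[%classic = 0%E.
Proof.
rewrite nuE//; apply: integral0_eq => x /=; rewrite in_itv/= => x0.
by rewrite lt0_exponential_pdf.
Qed.

(** Multiplying the density of rate [rate] by [expR (- a * x)] gives [rate / (rate + a)] times the
    density of rate [rate + a], whose total mass is 1. *)
Lemma laplace_exponential_law (a : R) : 0 <= a ->
  (\int[nu]_(x in `[0%R, +oo[) (expR (- a * x))%:E =
   (rate / (rate + a))%:E)%E.
Proof.
move=> a0; have ra0 : 0 < rate + a by rewrite ltr_wpDr.
have mexp : measurable_fun [set: measurableTypeR R]
    (fun x : R => (expR (- a * x))%:E).
  have mexp : measurable_fun [set: R] (fun x : R => expR (- a * x)).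
    by apply: measurableT_comp => //; exact: measurable_funM.
  by move/measurable_EFinP : mexp.
rewrite integral_exponential_law//=; last first.
  (* On the nonnegative half-line the integrand is at most 1, and [nu] is finite. *)
  apply: (@le_integrable _ _ _ nu _ _ _ (cst 1%E)) => //.
    exact: measurable_funTS.
    move=> x; rewrite /= in_itv/= andbT => x0.
    rewrite normr1 lee_fin ger0_norm ?expR_ge0// -expR0 ler_expR mulNr oppr_le0.
    exact: mulr_ge0.
  exact: finite_measure_integrable_cst.
rewrite (eq_integral (fun x : measurableTypeR R =>
    (rate / (rate + a))%:E * (exponential_pdf (rate + a) x)%:E)%E); last first.
  move=> x; rewrite inE/= in_itv/= andbT => x0.
  rewrite !exponential_pdfE// -!EFinM; congr EFin.
  rewrite [RHS]mulrA divfK ?gt_eqF// mulrCA -expRD; congr (_ * expR _).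
  by rewrite -mulrDl -opprD [a + _]addrC.
have mpdf : measurable_fun [set: measurableTypeR R]
    (EFin \o exponential_pdf (rate + a)).
  by apply/measurable_EFinP; exact: measurable_exponential_pdf.
have pdf0 x : (0 <= (exponential_pdf (rate + a) x)%:E)%E.
  by rewrite lee_fin exponential_pdf_ge0// ltW.
rewrite ge0_integralZl//=; last 2 first.
- exact: measurable_funTS.
- by rewrite lee_fin divr_ge0// ltW.
rewrite [X in (_ * X)%E](_ : _ = 1%E) ?mule1//.
rewrite -(integral_exponential_pdf ra0) [LHS]integral_mkcond/=.
apply: eq_integral => x _; rewrite patchE; case: ifPn => // /negP.
rewrite inE/= in_itv/= andbT => /negP; rewrite -ltNge => x0.
by rewrite lt0_exponential_pdf.
Qed.

End ExponentialLaw.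

(** * Tail of an exponential variable minus a weighted sum of independent ones *)

Section IndependentSums.
Context {disp : measure_display} {T : measurableType disp} {R : realType}.
Variable P : probability T R.

(** Both sides are finite measures in [D] that agree on rectangles, so uniqueness of the product
    measure applies. The event [E] carries the remaining variables through the induction on the
    interferers. *)
Lemma joint_law_indep (X Y : {RV P >-> R}) (E : set T) : measurable E ->
    (forall A B, measurable A -> measurable B ->
      P (X @^-1` A `&` Y @^-1` B `&` E) =
      (P (X @^-1` A) * P (Y @^-1` B) * P E)%E) ->
  forall D : set (R * R), measurable D ->
    P ((fun t => (X t, Y t)) @^-1` D `&` E) =
    ((distribution P X \x distribution P Y) D * P E)%E.
Proof.
move=> mE XYE D mD.
have mXY : measurable_fun setT (fun t => (X t, Y t)).
  by apply: measurable_fun_pair; exact: measurable_funPT.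
pose XY : {mfun T >-> (R * R)%type} :=
  HB.pack (fun t => (X t, Y t)) (isMeasurableFun.Build _ _ _ _ _ mXY).
pose c : {nonneg R} := NngNum (fine_ge0 (measure_ge0 P E)).
have cE : (c%:num)%:E = P E by rewrite fineK// fin_num_measure.
(* The factor [P E] is absorbed into the first marginal, which makes the right-hand side a product
   measure. *)
have <- : (mscale c (distribution P X) \x distribution P Y)%E D =
    ((distribution P X \x distribution P Y) D * P E)%E.
  rewrite [LHS]ge0_integral_mscale//=; last exact: measurable_fun_xsection.
  by rewrite cE muleC.
rewrite (@product_measure_unique _ _ _ _ R (mscale c (distribution P X))
  (distribution P Y) (pushforward (mrestr P mE) XY))// => A B mA mB.
transitivity (P (X @^-1` A `&` Y @^-1` B `&` E)); first by [].
by rewrite XYE// -cE muleC muleA.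
Qed.

Section UnitExponential.
Variable X : {RV P >-> R}.
Hypothesis X_exp : exponential_RV 1 X.

(* [measurableTypeR R] has the sigma-algebra of [R] but is the type carrying
   [lebesgue_measure], which the Radon-Nikodym theorem needs. *)
Let X' : {mfun T >-> measurableTypeR R} :=
  HB.pack (X : T -> measurableTypeR R)
    (isMeasurableFun.Build _ _ T (measurableTypeR R) X
       (@measurable_funPT _ _ _ _ X)).

Let X'E A : measurable A -> distribution P X' A = exponential_prob 1 A.
Proof. by move=> mA; rewrite -[in RHS]invr1 -X_exp. Qed.

Lemma exponential_RV_itvcy (c : R) : 0 <= c ->
  P (X @^-1` `[c, +oo[) = (expR (- c))%:E.
Proof.
by move=> c0; rewrite -[c in RHS]mul1r -mulNr -(exponential_law_itvcy ltr01 X'E).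
Qed.

Lemma exponential_RV_lt0 : P (X @^-1` `]-oo, 0[) = 0%E.
Proof. by rewrite -(exponential_law_lt0 X'E). Qed.

Lemma laplace_exponential_RV (a : R) : 0 <= a ->
  (\int[distribution P X]_(x in `[0%R, +oo[) (expR (- a * x))%:E =
   (1 / (1 + a))%:E)%E.
Proof.
move=> a0; rewrite -(laplace_exponential_law ltr01 X'E a0).
have mexp : measurable_fun [set: R] (fun x : R => expR (- a * x)).
  by apply: measurableT_comp => //; exact: measurable_funM.
(* Pulled back to [T], the integrals against the laws of [X] and [X'] coincide, since these are the
   same function. *)
rewrite !ge0_integral_pushforward//.
- by move/measurable_EFinP : mexp; exact: measurable_funTS.
- by move/measurable_EFinP : mexp; exact: measurable_funTS.
Qed.

End UnitExponential.

Variables (I : finType) (X : I -> {RV P >-> R}).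
Hypothesis X_indep : independent_RVs X.

Let cap (J : {set I}) (B : I -> set R) := \bigcap_(i in [set` J]) X i @^-1` B i.

Let cap0 B : cap finset.set0 B = setT.
Proof. by apply/seteqP; split=> // t _ i /=; rewrite inE. Qed.

Let measurable_cap (J : {set I}) B : (forall i, measurable (B i)) -> measurable (cap J B).
Proof.
move=> mB; apply: fin_bigcap_measurable; first exact: finite_finset.
by move=> i _; exact: measurable_funPTI.
Qed.

(** A condition on a fresh variable is folded into the family [B], so that independence hypotheses
    about a single [cap] apply to it. *)
Let cap_setU1 (J : {set I}) B i (A : set R) : i \notin J ->
  cap (i |: J) (fun j => if j == i then A else B j) = X i @^-1` A `&` cap J B.
Proof.
move=> iJ; apply/seteqP; split=> t.
- move=> h; split.
    by have := h i; rewrite /= !inE eqxx; exact.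
  move=> j /= jJ; have := h j; rewrite /= !inE jJ orbT => /(_ isT).
  by case: eqP => // ji; rewrite -ji jJ in iJ.
- move=> [Ai h] j /=; rewrite !inE; case: eqP => [->//|_ /=]; exact: h.
Qed.

Let indep_setU1 (J : {set I}) B i (A : set R) : i \notin J -> measurable A ->
    (forall i, measurable (B i)) ->
  P (X i @^-1` A `&` cap J B) = (P (X i @^-1` A) * P (cap J B))%E.
Proof.
move=> iJ mA mB; rewrite -cap_setU1// !X_indep//; last by move=> j; case: ifP.
rewrite big_setU1//= eqxx; congr (_ * _)%E; apply: eq_bigr => j jJ.
by case: eqP => // ji; rewrite -ji jJ in iJ.
Qed.

Variables (i0 : I) (a : I -> R).

(** Built by recursion from bundled measurable functions, so that each stage has a [distribution]
    and the head of [s] is subtracted last. *)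
Let excess (s : seq I) : {RV P >-> R} :=
  foldr (fun i (W : {mfun T >-> R}) => (W \- (a i \o* X i) : {mfun T >-> R}))
    (X i0) s.

Let excessE s t : excess s t = X i0 t - \sum_(i <- s) a i * X i t.
Proof.
elim: s => [|i s IH] /=; first by rewrite big_nil subr0.
by rewrite IH big_cons opprD addrA addrAC [a i * _]mulrC.
Qed.

Let measurable_slope b (A : set R) : measurable A ->
  measurable [set z : R * R | A (z.2 - z.1 * b)].
Proof.
move=> mA; rewrite -[X in measurable X]setTI.
have mf : measurable_fun setT (fun z : R * R => z.2 - z.1 * b).
  by apply: measurable_funB => //; apply: measurable_funM.
exact: mf.
Qed.

(** Independence of [excess s] from the variables in [i |: J] is a premise here, because the lemma
    also serves inside the induction that proves this independence. *)
Let excess_cons_joint i s (J : {set I}) B D : measurable D ->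
    (forall i, measurable (B i)) -> i \notin J ->
    (forall (J' : {set I}) A B', measurable A -> (forall i, measurable (B' i)) ->
      J' \subset i |: J -> P (excess s @^-1` A `&` cap J' B') =
      (P (excess s @^-1` A) * P (cap J' B'))%E) ->
  P ((fun t => (X i t, excess s t)) @^-1` D `&` cap J B) =
  ((distribution P (X i) \x distribution P (excess s)) D * P (cap J B))%E.
Proof.
move=> mD mB iJ IH; apply: joint_law_indep => //; first exact: measurable_cap.
move=> A1 A2 mA1 mA2.
rewrite -setIA setICA -cap_setU1// IH//; last by move=> j; case: ifP.
by rewrite cap_setU1// indep_setU1// muleCA muleA.
Qed.

(** In the inductive step the event on [excess (i :: s)] is an event on the pair [(X i, excess s)],
    which is jointly independent of [cap J B]. *)
Let excess_indep s : uniq (i0 :: s) -> forall (J : {set I}) A B,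
    measurable A -> (forall i, measurable (B i)) ->
    {in J, forall i, i \notin i0 :: s} ->
  P (excess s @^-1` A `&` cap J B) = (P (excess s @^-1` A) * P (cap J B))%E.
Proof.
elim: s => [_|i s IH us] J A B mA mB Js.
  by rewrite indep_setU1//; apply/negP => /Js; rewrite inE eqxx.
have iJ : i \notin J by apply/negP => /Js; rewrite !inE eqxx orbT.
move: us; rewrite /= inE negb_or => /and3P[/andP[i0i i0s] is_ us].
have {}IH (J' : {set I}) A' B' : measurable A' ->
    (forall i, measurable (B' i)) -> J' \subset i |: J ->
    P (excess s @^-1` A' `&` cap J' B') =
    (P (excess s @^-1` A') * P (cap J' B'))%E.
  move=> mA' mB' /fintype.subsetP J'J; apply: IH => //; first by rewrite /= i0s.
  move=> j /J'J; rewrite !inE => /orP[/eqP->|/Js].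
    by rewrite negb_or is_ eq_sym i0i.
  by rewrite !inE !negb_or => /and3P[-> _ ->].
have -> : excess (i :: s) @^-1` A = (fun t => (X i t, excess s t)) @^-1`
    [set z : R * R | A (z.2 - z.1 * a i)] by [].
have mD := measurable_slope (a i) mA.
rewrite excess_cons_joint//; congr (_ * _)%E.
(* With [J] empty the conditioning event is the whole space, which turns the product measure back
   into the probability of the event on the pair. *)
have := @excess_cons_joint i s finset.set0 B _ mD mB.
rewrite inE cap0 setIT probability_setT mule1 => ->// J' A' B' mA' mB' J'i.
apply: IH => //; apply: fintype.subset_trans J'i _.
by rewrite finset.setU0 finset.sub1set finset.setU11.
Qed.

Hypothesis X_exp : forall i, exponential_RV 1 (X i).
Hypothesis a_ge0 : forall i, 0 <= a i.

Lemma exponential_excess_tail s c : uniq (i0 :: s) -> 0 <= c ->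
  P [set t | c <= X i0 t - \sum_(i <- s) a i * X i t] =
  (expR (- c) * \prod_(i <- s) (1 / (1 + a i)))%:E.
Proof.
move=> us c0.
have -> : [set t | c <= X i0 t - \sum_(i <- s) a i * X i t] =
    excess s @^-1` `[c, +oo[.
  by apply/seteqP; split=> t /=; rewrite in_itv/= andbT excessE.
(* The level [c] stays general: the induction hypothesis is used at [c + a i * x]. *)
elim: s us c c0 => [_|i s IH us] c c0.
  by rewrite big_nil mulr1 (exponential_RV_itvcy (X_exp i0)).
have ius : uniq (i0 :: s).
  by move: us => /=; rewrite inE negb_or => /and3P[/andP[_ ->] _ ->].
pose D := [set z : R * R | `[c, +oo[%classic (z.2 - z.1 * a i)].
have mD : measurable D by exact: measurable_slope.
have -> : P (excess (i :: s) @^-1` `[c, +oo[) =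
    (distribution P (X i) \x distribution P (excess s))%E D.
  have := @excess_cons_joint i s finset.set0 (fun=> setT) D mD
    (fun=> measurableT).
  rewrite inE cap0 setIT probability_setT mule1 => ->// J' A' B' mA' mB' J'i.
  apply: excess_indep => // j /(fintype.subsetP J'i).
  rewrite !inE orbF => /eqP->.
  move: us => /=; rewrite inE negb_or => /and3P[/andP[i0i _] is_ _].
  by rewrite negb_or is_ eq_sym i0i.
rewrite /product_measure1 /=.
have ms := @measurable_fun_xsection _ _ _ _ _ (distribution P (excess s)) D mD.
(* The negative half-line is split off: it is null for the law of [X i], and for negative [x] the
   level [c + a i * x] may be negative, outside the range of the induction hypothesis. *)
rewrite -(setUv `[0%R, +oo[%classic) ge0_integral_setU//=; last 3 first.
- exact: measurableC.
- by rewrite setUv.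
- exact/disj_setPCl.
rewrite [X in (_ + X)%E]null_set_integral ?adde0//; last 3 first.
- exact: measurableC.
- exact: measurable_funTS.
- by rewrite setCitvr; exact: exponential_RV_lt0.
rewrite (eq_integral (fun x =>
  (expR (- c) * \prod_(i <- s) (1 / (1 + a i)))%:E * (expR (- a i * x))%:E)%E);
  last first.
  move=> x; rewrite inE/= in_itv/= andbT => x0.
  have cx0 : 0 <= c + a i * x by rewrite addr_ge0// mulr_ge0.
  have -> : xsection D x = `[c + a i * x, +oo[%classic.
    apply/seteqP; split=> w; rewrite /xsection/= in_setE /D/= !in_itv/= !andbT;
      by rewrite lerBrDr [x * _]mulrC.
  rewrite [LHS](IH ius _ cx0) -EFinM; congr EFin.
  by rewrite opprD expRD mulrAC mulNr.
rewrite ge0_integralZl//=; last 2 first.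
- have mexp : measurable_fun [set: R] (fun x : R => expR (- a i * x)).
    by apply: measurableT_comp => //; exact: measurable_funM.
  by move/measurable_EFinP : mexp; exact: measurable_funTS.
- rewrite lee_fin mulr_ge0 ?expR_ge0// prodr_ge0// => k _.
  by rewrite divr_ge0// addr_ge0.
rewrite laplace_exponential_RV// -EFinM big_cons; congr EFin.
by rewrite [RHS]mulrCA mulrC.
Qed.

End IndependentSums.

(** * Union of finitely many independent events *)

(** Independence must pass to complements. An induction over mixed intersections does this, with [J]
    the indices of events that occur and [s] those of events that fail. *)
Lemma independent_events_bigcup (disp : measure_display)
    (T : measurableType disp) (R : realType) (P : probability T R)
    (I : finType) (E : I -> set T) (p : I -> R) :
    (forall i, measurable (E i)) -> independent_events P E ->
    (forall i, P (E i) = (p i)%:E) ->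
  P (\bigcup_i E i) = (1 - \prod_i (1 - p i))%:E.
Proof.
move=> mE indE PE.
pose cap (J : {set I}) := \bigcap_(i in [set` J]) E i.
pose capC (s : seq I) := \bigcap_(i in [set` s]) ~` E i.
have mcap J : measurable (cap J).
  by apply: fin_bigcap_measurable => //; exact: finite_finset.
have mcapC s : measurable (capC s).
  by apply: fin_bigcap_measurable => // i _; exact: measurableC.
have PcapC s : uniq s -> forall J : {set I}, {in J, forall i, i \notin s} ->
    P (cap J `&` capC s) =
    ((\prod_(i in J) p i) * \prod_(i <- s) (1 - p i))%:E.
  elim: s => [_|i s IH /= /andP[is_ us]] J Js.
    rewrite (_ : capC [::] = setT) ?setIT; last first.
      by apply/seteqP; split=> // t _ i.
    rewrite indE big_nil mulr1 -prodEFin.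
    by apply: eq_bigr.
  have Js' : {in J, forall i, i \notin s}.
    by move=> j /Js; rewrite inE negb_or => /andP[].
  have iJ : i \notin J by apply/negP => /Js; rewrite inE eqxx.
  (* Complementing [E i] gives a difference of two probabilities, the second with [i] moved into
     [J]; hence [J] is general in the induction. *)
  have -> : cap J `&` capC (i :: s) = (cap J `&` capC s) `\` E i.
    apply/seteqP; split=> t.
      move=> [JT h]; split; last by apply: (h i); rewrite /= inE eqxx.
      by split=> // j /= js; apply: (h j); rewrite /= inE js orbT.
    move=> [[Jt h] Eit]; split=> // j /=; rewrite inE => /orP[/eqP->//|].
    exact: h.
  have mJs : measurable (cap J `&` capC s) by exact: measurableI.
  rewrite measureD//; last by rewrite -ge0_fin_numE// fin_num_measure.
  have -> : cap J `&` capC s `&` E i = cap (i |: J) `&` capC s.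
    apply/seteqP; split=> t.
      move=> [[Jt st] Et]; split=> // j /=; rewrite !inE => /orP[/eqP->//|].
      exact: Jt.
    move=> [Jt st]; split; last by apply: Jt; rewrite /= setU11.
    by split=> // j /= jJ; apply: Jt; rewrite /= setU1r.
  transitivity (P (cap J `&` capC s) - P (cap (i |: J) `&` capC s))%E => //.
  rewrite !IH//; last first.
    by move=> j; rewrite !inE => /orP[/eqP->//|/Js'].
  rewrite big_setU1//= big_cons -EFinB; congr EFin.
  by rewrite mulrBl mulrBr mul1r mulrCA mulrA.
have -> : \bigcup_i E i = ~` (cap finset.set0 `&` capC (index_enum I)).
  rewrite -[LHS]setCK setC_bigcup; congr (~` _); apply/seteqP; split=> t.
    by move=> h; split=> i /=; [rewrite inE|move=> _; exact: h].
  by move=> [_ h] i _; apply: h; exact: mem_index_enum.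
rewrite probability_setC; last exact: measurableI.
rewrite PcapC ?index_enum_uniq//; last by move=> i; rewrite inE.
by rewrite big_set0 mul1r.
Qed.

(** * Reception at a single receiver *)

Lemma measurable_fun_bigsum d (T : measurableType d) (R : realType)
    (D : set T) (I : Type) (s : seq I) (f : I -> T -> R) :
    (forall i, measurable_fun D (f i)) ->
  measurable_fun D (fun t => \sum_(i <- s) f i t).
Proof.
move=> mf; elim: s => [|i s IH].
  under eq_fun do rewrite big_nil.
  exact: measurable_cst.
under eq_fun do rewrite big_cons.
exact: measurable_funD.
Qed.

Section Reception.
Context {disp : measure_display} {T : measurableType disp} {R : realType}.
Variables (P : probability T R) (K eta G Pn beta : R) (m : nat).
Variables (dist_s pow_s : R) (dist pow : 'I_m -> R).
Variable gain : option 'I_m -> {RV P >-> R}.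
Hypotheses (K_gt0 : 0 < K) (G_gt0 : 0 < G) (Pn_gt0 : 0 < Pn).
Hypothesis beta_gt0 : 0 < beta.
Hypotheses (dist_s_gt0 : 0 < dist_s) (pow_s_gt0 : 0 < pow_s).
Hypotheses (dist_gt0 : forall i, 0 < dist i) (pow_gt0 : forall i, 0 < pow i).

Let signal t := received_power K eta dist_s pow_s (gain None t).
Let noise t :=
  interference_plus_noise K eta G Pn dist pow (fun i => gain (Some i) t).
Let rec := reception K eta G Pn beta dist_s pow_s dist pow gain.

(** At [Some i] this is [beta / G] times the ratio of the mean power from interferer [i] to the mean
    power from the sender. The tail lemma takes a nonnegative coefficient for every link, so the
    sender's link, absent from [links], gets 0. *)
Let weight (l : option 'I_m) : R :=
  if l is Some i then
    beta * pow i / (G * pow_s * (dist i / dist_s) `^ eta)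
  else 0.
Let threshold := beta * Pn * dist_s `^ eta / (pow_s * K).
Let links := [seq Some i | i <- index_enum 'I_m].

Let weight_ge0 l : 0 <= weight l.
Proof.
case: l => //= i; rewrite divr_ge0 ?mulr_ge0 ?powR_ge0//; exact: ltW.
Qed.

Let measurable_power l d q :
  measurable_fun setT (fun t => received_power K eta d q (gain l t)).
Proof.
apply: measurable_funM => //; apply: measurable_funM => //.
by apply: measurable_funM => //; exact: measurable_funPT.
Qed.

Let measurable_noise : measurable_fun setT noise.
Proof.
apply: measurable_funD => //; apply: measurable_funM => //.
apply: measurable_fun_bigsum => i; exact: measurable_power.
Qed.

Let measurable_le (f g : T -> R) : measurable_fun setT f ->
  measurable_fun setT g -> measurable [set t | f t <= g t].
Proof.
move=> mf mg; rewrite -[X in measurable X]setTI.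
exact: (measurable_fun_ler mf mg).
Qed.

(* Splitting on the sign of the noise avoids the measurability of the inverse;
   where the noise vanishes the quotient is 0, which is below beta. *)
Lemma measurable_reception : measurable rec.
Proof.
have mS : measurable_fun setT signal by exact: measurable_power.
have mbN : measurable_fun setT (fun t => beta * noise t).
  exact: measurable_funM.
have -> : rec =
    (~` [set t | noise t <= 0] `&` [set t | beta * noise t <= signal t]) `|`
    (~` [set t | 0 <= noise t] `&` [set t | signal t <= beta * noise t]).
  apply/seteqP; split=> t; rewrite /rec /reception /SINR /=.
    rewrite -/(signal t) -/(noise t).
    case: (ltrgt0P (noise t)) => N0.
    - by rewrite ler_pdivlMr// => ?; left.
    - by rewrite ler_ndivlMr// => ?; right.
    - by rewrite N0 invr0 mulr0 leNgt beta_gt0.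
  rewrite -/(signal t) -/(noise t).
  move=> [|] [] /negP; rewrite -ltNge => N0.
    by rewrite ler_pdivlMr.
  by rewrite ler_ndivlMr.
apply: measurableU; apply: measurableI; try apply: measurableC;
  exact: measurable_le.
Qed.

(** Nonnegative gains and [Pn > 0] make the noise positive, so the SINR condition clears its
    denominator. Dividing by the mean signal power [K * pow_s / dist_s ^ eta] then leaves the bare
    gain of the sender. *)
Let reception_excess t : (forall l, 0 <= gain l t) ->
  rec t <-> threshold <= gain None t - \sum_(l <- links) weight l * gain l t.
Proof.
move=> gain0.
have noise_gt0 : 0 < noise t.
  rewrite ltr_wpDl// mulr_ge0 ?invr_ge0 ?(ltW G_gt0)// sumr_ge0// => i _.
  by rewrite /received_power mulr_ge0 ?divr_ge0 ?mulr_ge0 ?powR_ge0// ltW.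
rewrite /rec /reception /SINR /= -/(signal t) -/(noise t) ler_pdivlMr//.
have ds0 : dist_s `^ eta != 0 by rewrite gt_eqF// powR_gt0.
have Ks0 : K != 0 by rewrite gt_eqF.
have ps0 : pow_s != 0 by rewrite gt_eqF.
have G0 : G != 0 by rewrite gt_eqF.
have u0 : 0 < dist_s `^ eta / (K * pow_s) by rewrite divr_gt0 ?mulr_gt0 ?powR_gt0.
rewrite -(ler_pM2r u0) lerBrDr.
have -> : signal t * (dist_s `^ eta / (K * pow_s)) = gain None t.
  by rewrite /signal /received_power; field; rewrite ds0 ps0 Ks0.
suff -> : beta * noise t * (dist_s `^ eta / (K * pow_s)) =
  threshold + \sum_(l <- links) weight l * gain l t by [].
rewrite /noise /interference_plus_noise /threshold big_map mulrDr mulrDl addrC.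
congr (_ + _); first by field; rewrite ps0 Ks0.
rewrite !mulr_sumr mulr_suml; apply: eq_bigr => i _ /=.
have di0 : dist i `^ eta != 0 by rewrite gt_eqF// powR_gt0.
(* The power of the quotient is split so that [field] sees only the two separate powers. *)
have -> : (dist i / dist_s) `^ eta = dist i `^ eta / dist_s `^ eta.
  apply: (mulIf ds0); rewrite divfK// -powRM ?divfK ?gt_eqF// ?ltW//.
  by rewrite divr_gt0.
by rewrite /received_power; field; rewrite ?ds0 ?ps0 ?Ks0 ?G0 ?di0.
Qed.

Hypothesis gain_exp : forall l, exponential_RV 1 (gain l).
Hypothesis gain_indep : independent_RVs gain.

Lemma reception_probability :
  P rec = (expR (- (beta * Pn * dist_s `^ eta / (pow_s * K))) *
    \prod_(i < m)
      (1 / (1 + beta * pow i / (G * pow_s * (dist i / dist_s) `^ eta))))%:E.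
Proof.
pose V := [set t | threshold <=
  gain None t - \sum_(l <- links) weight l * gain l t].
have ulinks : uniq (None :: links).
  rewrite /= map_inj_uniq ?index_enum_uniq ?andbT; last by move=> i j [].
  by apply/negP => /mapP[].
have threshold_ge0 : 0 <= threshold.
  by rewrite divr_ge0 ?mulr_ge0 ?powR_ge0// ltW.
have PV := exponential_excess_tail gain_indep gain_exp weight_ge0 ulinks
  threshold_ge0.
rewrite big_map in PV; rewrite -[RHS]PV -/V.
(* [rec] and [V] need only agree on [Q], where all gains are nonnegative. By independence [Q] has
   probability 1, so adding its null complement to both sets changes neither probability. *)
pose Q := \bigcap_(l in [set` [set: option 'I_m]%SET]) gain l @^-1` `[0, +oo[.
have mQ : measurable Q.
  apply: fin_bigcap_measurable; first exact: finite_finset.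
  by move=> l _; exact: measurable_funPTI.
have PQ : P (~` Q) = 0%E.
  rewrite probability_setC// gain_indep//.
  rewrite big1 ?subee// => l _.
  by rewrite (exponential_RV_itvcy (gain_exp l))// oppr0 expR0.
have mV : measurable V.
  apply: measurable_le => //; apply: measurable_funB => //.
  apply: measurable_fun_bigsum => l; apply: measurable_funM => //.
rewrite -(measureU0 measurable_reception _ PQ); last exact: measurableC.
rewrite -(measureU0 mV _ PQ); last exact: measurableC.
congr (P _); apply/seteqP; split=> t.
- have [Qt|nQt] := pselect (Q t); last by right.
  have gain0 l : 0 <= gain l t.
    by have := Qt l; rewrite /= inE in_itv/= andbT; exact.
  by move=> [/(reception_excess gain0)|//]; left.
- have [Qt|nQt] := pselect (Q t); last by right.
  have gain0 l : 0 <= gain l t.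
    by have := Qt l; rewrite /= inE in_itv/= andbT; exact.
  by move=> [/(reception_excess gain0)|//]; left.
Qed.

End Reception.

Theorem corollary1 (R : realType) (disp : measure_display)
    (T : measurableType disp) (P : probability T R)
    (eta K G Pn beta : R)
    (eta_ge2 : 2 <= eta) (eta_le5 : eta <= 5)
    (K_gt0 : 0 < K) (G_gt0 : 0 < G) (Pn_gt0 : 0 < Pn) (beta_gt0 : 0 < beta)
    (PTs : R) (PTs_gt0 : 0 < PTs)
    (nrel : nat) (nrel_ge1 : (1 <= nrel)%N)
    (ds : 'I_nrel -> R) (ds_gt0 : forall j, 0 < ds j)
    (m : 'I_nrel -> nat)
    (PT : forall j : 'I_nrel, 'I_(m j) -> R)
    (PT_gt0 : forall j i, 0 < PT j i)
    (dist : forall j : 'I_nrel, 'I_(m j) -> R)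
    (dist_gt0 : forall j i, 0 < dist j i)
    (alpha2 : forall j : 'I_nrel, option 'I_(m j) -> {RV P >-> R})
    (alpha2_exp : forall j l, exponential_RV 1 (alpha2 j l))
    (alpha2_indep : forall j, independent_RVs (alpha2 j))
    (reception_indep : independent_events P (fun j : 'I_nrel =>
       reception K eta G Pn beta (ds j) PTs (dist j) (PT j) (alpha2 j))) :
  P (\bigcup_(j : 'I_nrel)
       reception K eta G Pn beta (ds j) PTs (dist j) (PT j) (alpha2 j)) =
  (1 - \prod_(j < nrel)
     (1 - expR (- (beta * Pn * ds j `^ eta / (PTs * K))) *
          \prod_(i < m j)
            (1 / (1 + beta * PT j i /
                      (G * PTs * (dist j i / ds j) `^ eta)))))%:E.
Proof.
apply: independent_events_bigcup => // j.
- exact: measurable_reception.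
- exact: reception_probability.
Qed.
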